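(* Let $c\ge 1$ and $n_1\ge n_2\ge\cdots\ge n_c\ge 1$ be integers, and let $N=n_1+1+\sum_{i=1}^{c}(n_i-1)$. Then the star-critical Ramsey number satisfies $r_*(n_1K_2,n_2K_2,\ldots,n_cK_2)=\sum_{i=2}^{c}(n_i-1)+1$; that is, the smallest positive integer $k$ such that every $c$-edge-coloring of $K_{N-1}\sqcup K_{1,k}$ contains, for some $i\in\{1,\ldots,c\}$, a matching of $n_i$ edges all of color $i$, equals $\sum_{i=2}^{c}(n_i-1)+1$.
   Context: $n_iK_2$ denotes a matching of $n_i$ pairwise vertex-disjoint edges. For integers $m\ge 2$ and $k$, $K_{m-1}\sqcup K_{1,k}$ denotes the graph obtained from the complete graph $K_{m-1}$ by adding a new vertex $v$ and joining $v$ to $k$ vertices of $K_{m-1}$. The number $N=n_1+1+\sum_{i=1}^{c}(n_i-1)$ is the Ramsey number $r(n_1K_2,\ldots,n_cK_2)$, i.e., the smallest $n$ such that every $c$-edge-colored $K_n$ contains a matching of $n_i$ edges of color $i$ for some $i$. For $H_1,\ldots,H_c$ with $n=r(H_1,\ldots,H_c)$, the star-critical Ramsey number $r_*(H_1,\ldots,H_c)$ is the smallest positive integer $k$ such that every $c$-edge-coloring of $K_{n-1}\sqcup K_{1,k}$ contains a subgraph isomorphic to $H_i$ in color $i$ for some $i$. *)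

(* Defs.v *)
From mathcomp Require Import all_boot.

Set Implicit Arguments.
Unset Strict Implicit.
Unset Printing Implicit Defensive.

Record sgraph := SGraph {
  vertex :> finType;
  adj : rel vertex;
  adj_sym : symmetric adj;
  adj_irrefl : irreflexive adj }.

Definition edges (G : sgraph) : {set {set G}} :=
  [set [set p.1; p.2] | p in [set p : G * G | adj p.1 p.2]].

Lemma complete_sym n : symmetric (fun i j : 'I_n => i != j).
Proof. by move=> i j; rewrite eq_sym. Qed.
Lemma complete_irrefl n : irreflexive (fun i j : 'I_n => i != j).
Proof. by move=> i; rewrite eqxx. Qed.
Definition complete (n : nat) : sgraph :=
  SGraph (@complete_sym n) (@complete_irrefl n).

(* The added vertex is [None]; its neighbours are the first [k] vertices of
   the complete graph on ['I_p], so [k <= p] is intended. *)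
Definition complete_star_adj (p k : nat) (x y : option 'I_p) : bool :=
  match x, y with
  | Some i, Some j => i != j
  | None, Some i | Some i, None => i < k
  | None, None => false
  end.
Lemma complete_star_sym p k : symmetric (@complete_star_adj p k).
Proof. by move=> [i|] [j|] //=; rewrite eq_sym. Qed.
Lemma complete_star_irrefl p k : irreflexive (@complete_star_adj p k).
Proof. by move=> [i|] //=; rewrite eqxx. Qed.
Definition complete_star (p k : nat) : sgraph :=
  SGraph (@complete_star_sym p k) (@complete_star_irrefl p k).

Definition nK2_adj (n : nat) (x y : 'I_n * bool) : bool :=
  (x.1 == y.1) && (x.2 != y.2).
Lemma nK2_sym n : symmetric (@nK2_adj n).
Proof. by move=> x y; rewrite /nK2_adj eq_sym (eq_sym x.2). Qed.
Lemma nK2_irrefl n : irreflexive (@nK2_adj n).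
Proof. by move=> x; rewrite /nK2_adj !eqxx. Qed.
Definition nK2 (n : nat) : sgraph := SGraph (@nK2_sym n) (@nK2_irrefl n).

(* A [c]-edge-coloring is given by a function on all vertex sets, of which only
   the values on [edges G] are ever used; for [c > 0] every coloring of
   [edges G] extends to such a function. *)
Definition coloring (G : sgraph) (c : nat) := {set G} -> 'I_c.

Definition mono_copy (G : sgraph) (c : nat) (col : coloring G c) (i : 'I_c)
    (H : sgraph) : Prop :=
  exists2 f : H -> G, injective f &
    forall x y : H, adj x y -> adj (f x) (f y) /\ col [set f x; f y] = i.

Definition mono_matching (G : sgraph) (c : nat) (col : coloring G c) (i : 'I_c)
    (m : nat) : Prop :=
  exists M : {set {set G}},
    [/\ M \subset edges G, trivIset M, #|M| = m
      & forall e, e \in M -> col e = i].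

Definition arrows (G : sgraph) (c : nat) (H : 'I_c -> sgraph) : Prop :=
  forall col : coloring G c, exists i : 'I_c, mono_copy col i (H i).

Definition is_least (P : nat -> Prop) (k : nat) : Prop :=
  P k /\ forall j, P j -> k <= j.

Definition is_ramsey_number (c : nat) (H : 'I_c -> sgraph) (n : nat) : Prop :=
  is_least (fun m => arrows (complete m) H) n.

Definition is_star_critical_ramsey_number (c : nat) (H : 'I_c -> sgraph)
    (k : nat) : Prop :=
  exists2 n, is_ramsey_number H n &
    is_least (fun j => 0 < j <= n.-1 /\ arrows (complete_star n.-1 j) H) k.

(* Main.v *)
(* Upper bound.  Put t_i = n_i - 1 and suppose that color i has no matching
   with more than t_i edges.  By Tutte-Berge there is a set S_i of
   s_i <= t_i vertices off which color i has at most as many edges as a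
   complete graph on 2 m_i + 1 vertices, where m_i = t_i - s_i.  Let
   s = sum m_i.  At least t_1 + s + 2 vertices lie outside every S_i, and at
   most 2 t_1 edges are missing, so counting ordered pairs gives
     (t_1 + s + 2)(t_1 + s + 1) <= 4 t_1 + 2 (2 t_1 + 1) s,
   that is, x^2 - x + 2 <= 0 for x = t_1 - s, which is impossible.

   Lower bound.  Choose disjoint sets A_i of t_i vertices for i >= 2 and color
   an edge with some i such that it meets A_i, or with 1 if there is none; the
   added vertex is adjacent only to vertices of the A_i. *)
Require Import Defs.
From mathcomp Require Import all_boot zify.

Set Implicit Arguments.
Unset Strict Implicit.
Unset Printing Implicit Defensive.

(** * Matchings as involutions *)

Section Involutions.

Variable T : finType.
Implicit Types (e : rel T) (f g : {ffun T -> T}) (x y z u v w : T).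

(** A matching is an involution swapping the ends of its edges and fixing the vertices it misses. *)
Definition matching e f :=
  [forall x, (f (f x) == x) && ((f x != x) ==> e x (f x))].

Definition covered f := [set x | f x != x].

Definition maximum e f :=
  matching e f && [forall g, matching e g ==> (#|covered g| <= #|covered f|)].

Lemma matchingP e f :
  reflect (involutive f /\ forall x, f x != x -> e x (f x)) (matching e f).
Proof.
apply: (iffP forallP) => [fP | [fK fe] x].
  by split=> x; have /andP[/eqP fK /implyP] := fP x.
by rewrite fK eqxx; apply/implyP/fe.
Qed.

Lemma maximumP e f :
  reflect (matching e f /\
           forall g, matching e g -> #|covered g| <= #|covered f|)
          (maximum e f).
Proof.
apply: (iffP andP) => -[fM fmax]; split=> //.
  by move=> g gM; apply: (implyP (forallP fmax g)).
by apply/forallP => g; apply/implyP/fmax.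
Qed.

Lemma maximum_exists e : exists f, maximum e f.
Proof.
have idM : matching e [ffun x => x].
  by apply/matchingP; split=> x; rewrite !ffunE // eqxx.
case: (arg_maxnP (fun f => #|covered f|) idM) => f fM fmax.
by exists f; apply/maximumP.
Qed.

(** For [x] missed by [g]: add the edge [xy] and drop the edge at [y], if any, so that [g y] becomes
    missed. *)
Definition relink x y g : {ffun T -> T} :=
  [ffun w => if w == x then y else if w == y then x
             else if w == g y then w else g w].

Lemma relink_matching e x y g :
    symmetric e -> matching e g -> g x = x -> x != y -> e x y ->
  matching e (relink x y g).
Proof.
move=> e_sym /matchingP[gK ge] gx xy exy.
have yx : (y == x) = false by rewrite eq_sym (negPf xy).
apply/matchingP; split=> w; rewrite !ffunE.
  case: (eqVneq w x) => [->|wx]; first by rewrite yx eqxx.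
  case: (eqVneq w y) => [->|wy]; first by rewrite eqxx.
  case: (eqVneq w (g y)) => [wgy|wgy].
    by rewrite (negPf wx) (negPf wy) wgy eqxx.
  have -> : (g w == x) = false.
    by apply/negbTE/eqP => gwx; move: wx; rewrite -(gK w) gwx gx eqxx.
  have -> : (g w == y) = false.
    by apply/negbTE/eqP => gwy; move: wgy; rewrite -gwy gK eqxx.
  by rewrite (inj_eq (inv_inj gK)) (negPf wy) gK.
case: (eqVneq w x) => [->|wx] //.
case: (eqVneq w y) => [->|wy]; first by rewrite e_sym.
by case: (eqVneq w (g y)) => [_|_]; [rewrite eqxx | apply: ge].
Qed.

Lemma relink_covered_eq x y g :
    involutive g -> g x = x -> g y != y ->
  #|covered (relink x y g)| = #|covered g|.
Proof.
move=> gK gx gy.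
have xy : x != y by apply: contraNneq gy => <-; rewrite gx.
have gyx : g y != x by apply: contraNneq xy => gyx; rewrite -[y]gK gyx gx.
have -> : covered (relink x y g) = x |: (covered g :\ g y).
  apply/setP=> w; rewrite !inE !ffunE.
  case: (eqVneq w x) => [->|wx] /=; first by rewrite eq_sym xy.
  case: (eqVneq w y) => [->|wy]; first by rewrite xy eq_sym gy.
  by case: (eqVneq w (g y)) => [->|_]; rewrite ?eqxx.
rewrite cardsU1 !inE gx eqxx andbF [in RHS](cardsD1 (g y)) !inE gK.
by rewrite eq_sym gy.
Qed.

Lemma relink_covered_lt x y g :
  x != y -> g x = x -> g y = y -> #|covered g| < #|covered (relink x y g)|.
Proof.
move=> xy gx gy; apply: proper_card; apply/properP; split.
  apply/subsetP=> w; rewrite !inE !ffunE.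
  case: (eqVneq w x) => [->|wx]; first by rewrite gx eqxx.
  case: (eqVneq w y) => [->|wy]; first by rewrite gy eqxx.
  by rewrite gy (negPf wy).
by exists x; rewrite !inE ?gx ?eqxx // ffunE eqxx eq_sym.
Qed.

(** If [y] were missed too, relinking along [xy] would give a larger matching. *)
Lemma maximum_adj_covered e x y g :
    symmetric e -> maximum e g -> x != y -> e x y -> g x = x ->
  g y != y.
Proof.
move=> e_sym /maximumP[gM gmax] xy exy gx; apply/eqP=> gy.
have := gmax _ (relink_matching e_sym gM gx xy exy).
by rewrite leqNgt relink_covered_lt.
Qed.

(** * Gallai's lemma and inseparable pairs *)

(** The relation of Gallai's lemma, made reflexive; for symmetric [e] it is an equivalence when
    every vertex is missed by some maximum matching. *)
Definition inseparable e x y :=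
  (x == y) || [forall f, maximum e f ==> (f x != x) || (f y != y)].

Lemma inseparable_sym e : symmetric (inseparable e).
Proof.
move=> x y; rewrite /inseparable eq_sym; congr orb.
by apply: eq_forallb => f; rewrite orbC.
Qed.

Lemma inseparableP e x y :
  reflect (x = y \/ forall f, maximum e f -> f x = x -> f y != y)
          (inseparable e x y).
Proof.
apply: (iffP orP) => -[xy|h];
  [by left; apply/eqP | right | by left; apply/eqP | right].
  move=> f fM fx; have := implyP (forallP h f) fM.
  by rewrite fx eqxx.
apply/forallP=> f; apply/implyP=> fM.
by case: (eqVneq (f x) x) => //= fx; apply: h.
Qed.

Lemma inseparable_adj e x y :
  symmetric e -> x != y -> e x y -> inseparable e x y.
Proof.
move=> e_sym xy exy; apply/inseparableP; right=> f fM.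
exact: (maximum_adj_covered e_sym fM xy exy).
Qed.

(* Gallai's lemma.  If [f] misses both [u] and [v], compare it with a maximum
   matching [g] missing [w] that agrees with [f] as much as possible: relinking
   [g] along an edge of [f] increases the agreement. *)
Lemma inseparable_trans e w u v :
    symmetric e -> (exists2 g, maximum e g & g w = w) ->
  inseparable e u w -> inseparable e w v -> inseparable e u v.
Proof.
move=> e_sym [g0 g0M g0w] uw wv.
case: (eqVneq u v) => [->|uv]; first by apply/inseparableP; left.
have [<- //|uw'] := eqVneq w u.
have [<- //|vw'] := eqVneq w v.
rewrite inseparable_sym in uw.
case/inseparableP: uw => [ /eqP|wu]; first by rewrite (negPf uw').
case/inseparableP: wv => [ /eqP|wv]; first by rewrite (negPf vw').
apply/inseparableP; right=> f fM fu; apply/eqP=> fv.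
pose agree g := #|[set p | (f p != p) && (f p == g p)]|.
have P0 : maximum e g0 && (g0 w == w) by rewrite g0M g0w eqxx.
case: (@arg_maxnP _ g0 (fun g => maximum e g && (g w == w)) agree P0)
  => g /andP[gM /eqP gw] gmax.
have [fm fmax] := maximumP _ _ fM; have [gm gmx] := maximumP _ _ gM.
have [fK fe] := matchingP _ _ fm; have [gK ge] := matchingP _ _ gm.
have cardfg : #|covered f| = #|covered g|.
  by apply/eqP; rewrite eqn_leq gmx // fmax.
(* The covered sets have equal size, and [u], [v] lie in [covered g] only: [g] misses [w], which is
   inseparable from both. *)
have : 1 < #|covered f :\: covered g|.
  have := cardsID (covered g) (covered f); have := cardsID (covered f) (covered g).
  rewrite setIC cardfg => <- /addnI ->.
  have -> : 2 = #|[set u; v]| by rewrite cards2 uv.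
  apply: subset_leq_card; apply/subsetP=> x; rewrite !inE.
  by case/orP=> /eqP ->; rewrite ?fu ?fv eqxx /= ?wu ?wv.
move=> /card_gt1P[a [b [aD bD ab]]].
(* A candidate other than [w] is needed for the relinked matching to miss [w] still. *)
have [x xD xw] : exists2 x, x \in covered f :\: covered g & x != w.
  have [aw|aw] := eqVneq a w; last by exists a.
  by exists b => //; rewrite -aw eq_sym.
move: xD; rewrite !inE negbK => /andP[/eqP gx fx].
have exy := fe _ fx.
have xy : x != f x by rewrite eq_sym.
have gy := maximum_adj_covered e_sym gM xy exy gx.
have wy : w != f x by apply: contraNneq gy => <-; rewrite gw.
have hM : maximum e (relink x (f x) g).
  apply/maximumP; split; first exact: relink_matching.
  by move=> h hm; rewrite relink_covered_eq // gmx.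
have hw : relink x (f x) g w == w.
  by rewrite ffunE (eq_sym w x) (negPf xw) (negPf wy) gw if_same.
have := gmax (relink x (f x) g); rewrite hM hw => /(_ isT).
(* The agreement gains [x] and loses nothing: if [f] and [g] agreed at the newly missed [g (f x)],
   that vertex would be [x]. *)
apply/negP; rewrite -ltnNge; apply: proper_card; apply/properP; split; last first.
  by exists x; rewrite !inE ?ffunE ?fx ?eqxx ?gx //.
apply/subsetP=> p; rewrite !inE ffunE => /andP[fp /eqP fgp]; rewrite fp /=.
have px : p != x by apply: contraNneq fp => px; rewrite fgp px gx.
have py : p != f x.
  apply: contraNneq xy => py; move: fgp; rewrite py fK => xg.
  by apply/eqP; rewrite -{1}gx {1}xg gK.
have pg : p != g (f x).
  apply: contraNneq px => pg; move: fgp; rewrite {2}pg gK => /(inv_inj fK) ->.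
  by [].
by rewrite (negPf px) (negPf py) (negPf pg) fgp.
Qed.

(** Each class contains at most one vertex missed by [f], so a missed coordinate is determined by
    the other one. *)
Lemma card_inseparable e f :
    symmetric e -> (forall w, exists2 g, maximum e g & g w = w) ->
    maximum e f ->
  #|[set p : T * T | (p.1 != p.2) && inseparable e p.1 p.2]|
    <= #|covered f| * #|covered f|.+1.
Proof.
move=> e_sym e_miss fM; set U := covered f; set D := [set p | _].
have missed_eq x y : x \notin U -> y \notin U -> inseparable e x y -> x = y.
  rewrite !inE !negbK => /eqP fx /eqP fy /inseparableP[//|/(_ f fM fx)].
  by rewrite fy eqxx.
have missed_eq2 x y y' : y \notin U -> y' \notin U ->
    inseparable e x y -> inseparable e x y' -> y = y'.
  move=> yU y'U xy xy'; apply: missed_eq => //.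
  by apply: inseparable_trans (e_miss x) _ xy' => //; rewrite inseparable_sym.
have DP x y : (x, y) \in D -> x != y /\ inseparable e x y.
  by rewrite inE => /andP[].
pose A := [set p : T * T | p.1 \in U].
have AP x y : ((x, y) \in A) = (x \in U) by rewrite inE.
clearbody U D A.
(* If the first coordinate is missed, the second is covered and determines it: at most [#|U|] pairs.
   The other pairs number at most [#|U| * #|U|]. *)
rewrite -(cardsID A) mulnS addnC; apply: leq_add.
  have inj2 : {in D :\: A &, injective (@snd T T)}.
    move=> [x y] [x' y']; rewrite !in_setD !AP => /andP[xU /DP[xy sxy]].
    move=> /andP[x'U /DP[xy' sxy']] /= yy'; subst y'; congr (_, _).
    rewrite inseparable_sym in sxy; rewrite inseparable_sym in sxy'.
    exact: missed_eq2 sxy sxy'.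
  rewrite -(card_in_imset inj2); apply: subset_leq_card.
  apply/subsetP=> _ /imsetP[[x y] + ->]; rewrite in_setD AP => /andP[xU /DP[xy sxy]].
  by apply: contraNT xy => yU; rewrite /= (missed_eq _ _ xU yU sxy).
(* A missed second coordinate is encoded by repeating the first; no pair of [D] is diagonal, so this
   code is free. *)
pose phi (p : T * T) := (p.1, if p.2 \in U then p.2 else p.1).
have inj1 : {in D :&: A &, injective phi}.
  move=> [x y] [x' y']; rewrite !in_setI !AP => /andP[/DP[xy sxy] xU].
  rewrite /phi /= => /andP[/DP[xy' sxy'] x'U].
  case: ifP => yU; case: ifP => y'U [xx' yy']; subst x'.
  - by rewrite yy'.
  - by rewrite yy' eqxx in xy.
  - by rewrite yy' eqxx in xy'.
  by rewrite (missed_eq2 _ _ _ (negbT yU) (negbT y'U) sxy sxy').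
rewrite -(card_in_imset inj1) -cardsX; apply: subset_leq_card.
apply/subsetP=> _ /imsetP[[x y] + ->]; rewrite in_setI AP in_setX => /andP[_ xU].
by rewrite /= xU; case: ifP.
Qed.

Lemma matching_edges e f : matching e f ->
  exists M : {set {set T}},
    [/\ trivIset M, #|covered f| = #|M| * 2
      & forall E, E \in M -> exists x, e x (f x) /\ E = [set x; f x]].
Proof.
move=> /matchingP[fK fe]; exists [set [set x; f x] | x in covered f].
have edge_of x z : z \in [set x; f x] -> [set x; f x] = [set z; f z].
  by rewrite !inE => /orP[]/eqP -> //; rewrite fK setUC.
have triv : trivIset [set [set x; f x] | x in covered f].
  apply/trivIsetP=> _ _ /imsetP[x xU ->] /imsetP[y yU ->].
  apply: contraNT; rewrite -setI_eq0 => /set0Pn[z] /setIP[/edge_of -> /edge_of ->].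
  by [].
split=> //; last first.
  by move=> _ /imsetP[x xU ->]; exists x; split=> //; apply: fe; rewrite inE in xU.
have cov : cover [set [set x; f x] | x in covered f] = covered f.
  apply/setP=> z; apply/bigcupP/idP => [[_ /imsetP[x + ->]]|zU].
    by rewrite !inE => xU /orP[]/eqP ->; rewrite ?fK // eq_sym.
  by exists [set z; f z]; rewrite ?set21 //; apply: imset_f.
rewrite -{1}cov; apply: card_uniform_partition.
  by move=> _ /imsetP[x + ->]; rewrite inE cards2 eq_sym => ->.
apply/and3P; split=> //; apply/imsetP=> -[x _ /setP/(_ x)].
by rewrite !inE eqxx.
Qed.

(** * A weak Tutte-Berge formula *)

(** Adjacent vertices are inseparable, so [card_inseparable] bounds the edges. *)
Lemma card_edges_all_missed e t :
    symmetric e -> (forall f, matching e f -> #|covered f| <= t) ->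
    (forall v, exists2 g, maximum e g & g v = v) ->
  #|[set p : T * T | (p.1 != p.2) && e p.1 p.2]| <= t * t.+1.
Proof.
move=> e_sym e_cov e_miss; have [f fM] := maximum_exists e.
have [fm _] := maximumP _ _ fM.
apply: leq_trans (leq_mul (e_cov f fm) (_ : #|covered f|.+1 <= t.+1));
  last exact: e_cov.
apply: leq_trans (card_inseparable e_sym e_miss fM).
apply: subset_leq_card; apply/subsetP=> -[x y]; rewrite !inE /=.
by case/andP=> xy exy; rewrite xy inseparable_adj.
Qed.

(* The weak form of the Tutte-Berge formula that is needed here: instead of
   the odd components of [T - S] it only records how many edges they can
   contain.  Edges are counted as ordered pairs. *)
Lemma tutte_berge_pairs e t :
    symmetric e -> (forall f, matching e f -> #|covered f| <= t.*2) ->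
  exists2 S : {set T}, #|S| <= t &
    #|[set p : T * T | [&& p.1 \notin S, p.2 \notin S, p.1 != p.2 & e p.1 p.2]]|
      <= (t - #|S|).*2 * (t - #|S|).*2.+1.
Proof.
(* If every maximum matching covers some [v], put [v] into [S] and induct on the rest; otherwise the
   empty [S] works. *)
elim: t e => [|t IH] e e_sym e_cov;
  have [f fM] := maximum_exists e; have [fm fmax] := maximumP _ _ fM;
  have [v /forallP vU|no_v] :=
    pickP (fun v => [forall f, maximum e f ==> (f v != v)]).
- have := e_cov f fm; rewrite leqn0 cards_eq0 => /eqP/setP/(_ v).
  by rewrite !inE (implyP (vU f) fM).
- exists set0; rewrite ?cards0 // subn0.
  apply: leq_trans (card_edges_all_missed e_sym e_cov _).
    by apply: subset_leq_card; apply/subsetP=> p; rewrite !inE.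
  move=> v; have /forallPn[g] := negbT (no_v v).
  by rewrite negb_imply negbK => /andP[gM /eqP gv]; exists g.
- pose e' x y := [&& e x y, x != v & y != v].
  have e'_sym : symmetric e'.
    move=> x y.
    by rewrite /e' e_sym [in RHS]andbC andbA andbAC -andbA andbC.
  have e'_cov g : matching e' g -> #|covered g| <= t.*2.
    move=> gm'; have [gK ge'] := matchingP _ _ gm'.
    have gm : matching e g.
      by apply/matchingP; split=> // x /ge' /and3P[].
    have gv : g v = v.
      by apply/eqP; apply: contraT => /ge' /and3P[_ /eqP].
    (* [g] misses [v], so it is not maximum for [e]; this leaves at most [2t + 1] covered vertices,
       and parity lowers it to [2t]. *)
    have lt_g : #|covered g| < t.+1.*2.
      rewrite (leq_trans _ (e_cov f fm)) // ltn_neqAle fmax // andbT.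
      apply/eqP=> gf; have /implyP := vU g.
      rewrite gv eqxx => /(_ _)/negP; apply=> //.
      by apply/maximumP; split=> // h; rewrite gf; apply: fmax.
    by have [M [_ cM _]] := matching_edges gm; lia.
  have [S leS cS] := IH e' e'_sym e'_cov.
  (* An inequality suffices: a smaller set only raises the bound on the pairs. *)
  have leS' : #|v |: S| <= #|S|.+1 by rewrite cardsU1; case: (_ \notin _).
  exists (v |: S); first by rewrite (leq_trans leS').
  apply: (@leq_trans ((t - #|S|).*2 * (t - #|S|).*2.+1));
    last by apply: leq_mul; lia.
  apply: leq_trans cS; apply: subset_leq_card; apply/subsetP=> -[x y].
  rewrite !inE /= !negb_or /e' => /and4P[/andP[-> ->] /andP[-> ->] -> ->].
  by [].
- exists set0; rewrite ?cards0 // subn0.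
  apply: leq_trans (card_edges_all_missed e_sym e_cov _).
    by apply: subset_leq_card; apply/subsetP=> p; rewrite !inE.
  move=> v; have /forallPn[g] := negbT (no_v v).
  by rewrite negb_imply negbK => /andP[gM /eqP gv]; exists g.
Qed.

End Involutions.

(** * Monochromatic matchings in dense graphs *)

Lemma subset_of_card (T : finType) (A : {set T}) m :
  m <= #|A| -> exists2 B : {set T}, B \subset A & #|B| = m.
Proof.
move=> le_m; exists [set x in take m (enum A)].
  by apply/subsetP=> x; rewrite inE => /mem_take; rewrite mem_enum.
rewrite cardsE (card_uniqP _) ?size_takel -?cardE //.
by rewrite take_uniq ?enum_uniq.
Qed.

Lemma leq_card_bigcup (T I : finType) (F : I -> {set T}) :
  #|\bigcup_i F i| <= \sum_i #|F i|.
Proof.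
elim/big_ind2: _ => [|m A p B hA hB|//]; first by rewrite cards0.
exact: leq_trans (leq_card_setU _ _) (leq_add hA hB).
Qed.

Section Colorings.

Variables (G : sgraph) (c : nat) (col : coloring G c).

Definition color_rel (i : 'I_c) : rel G :=
  fun x y => adj x y && (col [set x; y] == i).

Lemma color_rel_sym i : symmetric (color_rel i).
Proof. by move=> x y; rewrite /color_rel adj_sym setUC. Qed.

Lemma mem_edges (x y : G) : adj x y -> [set x; y] \in edges G.
Proof. by move=> xy; apply/imsetP; exists (x, y); rewrite ?inE. Qed.

Lemma matching_mono i m f :
  matching (color_rel i) f -> m.*2 < #|covered f| -> mono_matching col i m.+1.
Proof.
move=> fM lt_m; have [M [trivM cM ME]] := matching_edges fM.
have [B sBM cB] : exists2 B : {set {set G}}, B \subset M & #|B| = m.+1.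
  by apply: subset_of_card; lia.
exists B; split=> //.
- apply/subsetP=> E /(subsetP sBM)/ME[x [/andP[xy _] ->]].
  exact: mem_edges.
- apply/trivIsetP=> X Y /(subsetP sBM) XM /(subsetP sBM) YM.
  by apply: (trivIsetP trivM).
by move=> E /(subsetP sBM)/ME[x [/andP[_ /eqP <-] ->]].
Qed.

(* The missing pairs are ordered, so this allows [2 * t0] missing edges. *)
Lemma dense_mono_matching (t : 'I_c -> nat) (t0 : nat) :
    (forall i, t i <= t0) -> t0 + \sum_i t i + 2 <= #|G| ->
    #|[set p : G * G | (p.1 != p.2) && ~~ adj p.1 p.2]| <= 4 * t0 ->
  exists i, mono_matching col i (t i).+1.
Proof.
move=> t_le ltG missing.
have [/existsP[i /existsP[f /andP[fM ltf]]]|/existsPn none] :=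
  boolP [exists i, exists f, matching (color_rel i) f && ((t i).*2 < #|covered f|)].
  by exists i; apply: matching_mono fM ltf.
have cov i f : matching (color_rel i) f -> #|covered f| <= (t i).*2.
  move=> fM; have /existsPn/(_ f) := none i.
  by rewrite fM /= -leqNgt.
pose inner i (S : {set G}) :=
  [set p : G * G | [&& p.1 \notin S, p.2 \notin S, p.1 != p.2
                       & color_rel i p.1 p.2]].
have /fin_all_exists2[S leS cS] : forall i, exists2 S : {set G}, #|S| <= t i &
    #|inner i S| <= (t i - #|S|).*2 * (t i - #|S|).*2.+1.
  by move=> i; apply: tutte_berge_pairs (cov i); apply: color_rel_sym.
pose R := ~: \bigcup_i S i.
have cR : #|G| <= #|R| + \sum_i #|S i|.
  by rewrite -(cardsC (\bigcup_i S i)) addnC leq_add2l leq_card_bigcup.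
(* An ordered pair over [R] is diagonal, nonadjacent, or an edge of some color [i] avoiding
   [S i]. *)
have sub : setX R R \subset ([set p : G * G | (p.1 != p.2) && ~~ adj p.1 p.2]
    :|: \bigcup_i inner i (S i)) :|: [set (x, x) | x in R].
  apply/subsetP=> -[x y]; rewrite in_setX => /andP[xR yR]; rewrite !in_setU.
  have [xy|xy] := eqVneq x y.
    by rewrite -xy (imset_f (fun z => (z, z))) ?orbT.
  apply/orP; left; rewrite inE /= xy /=.
  case adj_xy: (adj x y) => //=; apply/bigcupP; exists (col [set x; y]) => //.
  rewrite inE /= xy /color_rel adj_xy eqxx /= andbT.
  move: xR yR; rewrite !in_setC => xR yR; apply/andP; split.
    by apply: contra xR => h; apply/bigcupP; exists (col [set x; y]).
  by apply: contra yR => h; apply/bigcupP; exists (col [set x; y]).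
have := subset_leq_card sub; rewrite cardsX => leR.
have {}leR := leq_trans leR (leq_card_setU _ _).
have {leR} := leq_trans leR (leq_add (leq_card_setU _ _) (leq_imset_card _ _)).
have := leq_card_bigcup (fun i => inner i (S i)).
(* Bounding the factor [2 m_i + 1] by [2 t0 + 1] makes the estimate linear, so only the sum of the
   [m_i] matters. *)
have : \sum_i #|inner i (S i)| <= (\sum_i (t i - #|S i|)) * (2 * (t0.*2.+1)).
  rewrite big_distrl; apply: leq_sum => i _; apply: leq_trans (cS i) _.
  have : t i - #|S i| <= t0 by rewrite (leq_trans (leq_subr _ _)).
  by move: (t i - _) => a le_a; rewrite -muln2 -mulnA leq_mul //; lia.
have sumE : \sum_i (t i - #|S i|) + \sum_i #|S i| = \sum_i t i.
  by rewrite -big_split; apply: eq_bigr => i _; rewrite /= subnK.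
move: sumE ltG cR missing.
set s := \sum_i (t i - _); set q := \sum_i #|S i|; set T := \sum_i t i.
set X := #|[set p : G * G | _]|; set Y := #|\bigcup_i inner _ _|.
set Z := \sum_i #|inner _ _|; set M := #|R| => sumE ltG cR hX hZ hY hM.
have : t0 + s + 2 <= M by lia.
have : M * M <= 4 * t0 + s * (2 * t0.*2.+1) + M by lia.
clear; move=> h1 h2; exfalso.
have h3 : (t0 + s + 2) * (t0 + s + 1) <= M * (M - 1) by apply: leq_mul; lia.
have {h1 h2 h3} : (t0 + s + 2) * (t0 + s + 1) <= 4 * t0 + s * (2 * t0.*2.+1).
  by apply: leq_trans h3 _; rewrite mulnBr muln1 leq_subLR addnC.
(* Splitting on the order of [t0] and [s] makes their difference [d] a natural number; the
   inequality becomes [d^2 - d + 2 <= 0] or [d^2 + d + 2 <= 0]. *)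
by case: (leqP t0 s) => [/subnKC <-|/ltnW/subnKC <-];
  [move: (s - t0) | move: (t0 - s)]; nia.
Qed.

End Colorings.

(** * Copies of [nK2] as matchings *)

Lemma mono_copy_matching (G : sgraph) c (col : coloring G c) i m :
  mono_copy col i (nK2 m) <-> mono_matching col i m.
Proof.
split=> [[f f_inj f_col]|[M [sME trivM cM colM]]].
  pose E (k : 'I_m) := [set f (k, false); f (k, true)].
  have E_mem k z : z \in E k -> exists b, z = f (k, b).
    by rewrite !inE => /orP[]/eqP ->; [exists false | exists true].
  have E_inj k l z : z \in E k -> z \in E l -> k = l.
    by move=> /E_mem[b ->] /E_mem[b' /f_inj[]].
  have E_col k : adj (f (k, false)) (f (k, true)) /\ col (E k) = i.
    by apply: f_col; rewrite /= /nK2_adj eqxx.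
  exists [set E k | k in [set: 'I_m]]; split.
  - by apply/subsetP=> _ /imsetP[k _ ->]; apply: mem_edges; case: (E_col k).
  - apply/trivIsetP=> _ _ /imsetP[k _ ->] /imsetP[l _ ->].
    apply: contraNT; rewrite -setI_eq0 => /set0Pn[z /setIP[zk zl]].
    by rewrite (E_inj _ _ _ zk zl).
  - rewrite card_imset ?cardsT ?card_ord // => k l kl.
    by apply: (E_inj _ _ (f (k, false))); rewrite -?kl set21.
  by move=> _ /imsetP[k _ ->]; case: (E_col k).
pose e (k : 'I_m) := enum_val (cast_ord (esym cM) k).
have eM k : e k \in M by apply: enum_valP.
have e_inj : injective e by move=> k l /enum_val_inj/cast_ord_inj.
have /fin_all_exists2[p p_adj pE] : forall k, exists2 p : G * G,
    adj p.1 p.2 & e k = [set p.1; p.2].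
  by move=> k; have /(subsetP sME)/imsetP[p + ->] := eM k; rewrite inE; exists p.
pose f (x : 'I_m * bool) := if x.2 then (p x.1).1 else (p x.1).2.
have fe x : f x \in e x.1.
  by rewrite pE /f; case: x.2; rewrite !inE eqxx ?orbT.
have f_neq k b b' : b != b' -> f (k, b) != f (k, b').
  have : (p k).1 != (p k).2.
    by apply/eqP=> pk; have := p_adj k; rewrite pk adj_irrefl.
  by rewrite /f; case: b b' => -[] //=; rewrite eq_sym.
exists f.
  move=> [k b] [l b'] fkl; have kl : k = l.
    apply: e_inj; apply/eqP; apply: contraT => /(trivIsetP trivM _ _ (eM k) (eM l)).
    move=> /disjointFr/(_ (fe (k, b))); by rewrite fkl (fe (l, b')).
  subst l; congr (_, _); apply/eqP; apply: contraT => /(f_neq k).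
  by rewrite fkl eqxx.
move=> [k b] [l b'] /= /andP[/eqP /= <-]; rewrite /f /=.
have := p_adj k; have := colM _ (eM k); rewrite pE.
by case: b b' => -[] //= pcol padj _; rewrite 1?adj_sym // setUC.
Qed.

(** * Colorings for the lower bounds *)

(** Choosing a point of [A] in each member of [M] is injective by disjointness. *)
Lemma card_trivIset_meet (T : finType) (M : {set {set T}}) (A : {set T}) :
  trivIset M -> (forall E, E \in M -> exists2 x, x \in E & x \in A) -> #|M| <= #|A|.
Proof.
move=> trivM meetM.
case: (set_0Vmem M) => [->|[E0 E0M]]; first by rewrite cards0.
have [x0 _ _] := meetM E0 E0M.
pose r E := odflt x0 [pick x in E :&: A].
have rP E : E \in M -> r E \in E /\ r E \in A.
  move=> EM; rewrite /r; case: pickP => [x /setIP[]//|none].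
  by have [x xE xA] := meetM E EM; have := none x; rewrite inE xE xA.
have r_inj : {in M &, injective r}.
  move=> E F EM FM rEF; apply/eqP; apply: contraT => /(trivIsetP trivM _ _ EM FM).
  by move=> /disjointFr/(_ (proj1 (rP E EM))); rewrite rEF (proj1 (rP F FM)).
rewrite -(card_in_imset r_inj); apply: subset_leq_card.
by apply/subsetP=> _ /imsetP[E EM ->]; case: (rP E EM).
Qed.

Lemma card_trivIset_in (T : finType) (M : {set {set T}}) (A : {set T}) :
    trivIset M -> (forall E, E \in M -> #|E| = 2 /\ E \subset A) ->
  #|M| * 2 <= #|A|.
Proof.
move=> trivM ME.
have -> : #|M| * 2 = #|cover M|.
  move: trivM => /eqP <-; rewrite -sum_nat_const.
  by apply: eq_bigr => E EM; case: (ME E EM).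
apply: subset_leq_card; apply/bigcupsP=> E EM.
by case: (ME E EM).
Qed.

(** An edge takes a label other than [i0] from one of its ends, if there is one. A matching in color
    [i != i0] then uses distinct vertices labelled [i], and one in color [i0] stays inside [W]. *)
Lemma labelled_coloring (G : sgraph) c (i0 : 'I_c) (n : 'I_c -> nat)
    (h : G -> 'I_c) (W : {set G}) :
    (forall i, i != i0 -> #|[set x | h x == i]| < n i) ->
    (forall x y, adj x y -> h x = i0 -> h y = i0 -> x \in W) ->
    #|W| < (n i0).*2 ->
  exists col : coloring G c, forall i, ~ mono_matching col i (n i).
Proof.
move=> h_small hW cW.
pose col (E : {set G}) := if [pick x in E | h x != i0] is Some x then h x else i0.
exists col => i [M [sME trivM cM colM]].
have [ii|ii] := eqVneq i i0; last first.
  have := h_small i ii; rewrite -cM ltnNge card_trivIset_meet // => E /colM.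
  rewrite /col; case: pickP => [x /andP[xE _] <-|_ /eqP];
    first by exists x; rewrite ?inE.
  by rewrite eq_sym (negPf ii).
subst i; have : #|M| * 2 <= #|W|; last by lia.
apply: card_trivIset_in => // E EM.
have /(subsetP sME)/imsetP[[x y]] := EM; rewrite inE /= => xy EE.
have all0 z : z \in E -> h z = i0.
  move: (colM E EM); rewrite /col; case: pickP => [w /andP[_ /eqP//]|none _ zE].
  by apply/eqP; have := none z; rewrite zE /= => /negbFE.
have [hx hy] : h x = i0 /\ h y = i0.
  by split; apply: all0; rewrite EE !inE eqxx ?orbT.
rewrite EE cards2; split.
  by case: eqP => // exy; rewrite exy adj_irrefl in xy.
apply/subsetP=> z; rewrite !inE => /orP[]/eqP ->; first exact: hW xy hx hy.
by apply: hW hy hx; rewrite adj_sym.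
Qed.

Lemma labelling_exists c (i0 : 'I_c) (t : 'I_c -> nat) :
  exists h : nat -> 'I_c,
    (forall x, (h x == i0) = (\sum_(i < c | i != i0) t i <= x)) /\
    forall m i, i != i0 -> #|[set x : 'I_m | h x == i]| <= t i.
Proof.
pose L := flatten [seq nseq (t i) i | i <- enum 'I_c & i != i0].
have sL : size L = \sum_(i < c | i != i0) t i.
  rewrite size_flatten sumnE /shape -map_comp big_map big_filter big_enum_cond.
  by apply: eq_bigr => i _; rewrite /= size_nseq.
have L0 : i0 \notin L.
  apply/flattenP=> -[_ /mapP[i + ->]]; rewrite mem_filter => /andP[ii _].
  by rewrite mem_nseq => /andP[_ /eqP ij]; rewrite ij eqxx in ii.
have cL i : i != i0 -> count_mem i L = t i.
  move=> ii; rewrite count_flatten sumnE -map_comp big_map big_filter big_enum_cond.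
  rewrite (bigD1 i) //= big1 ?addn0 => [|j /andP[_ ji]].
    by rewrite count_nseq /= eqxx mul1n.
  by rewrite count_nseq /= (negPf ji).
(* The default [i0] labels every position past the end of [L]. *)
exists (nth i0 L); split=> [x|].
  rewrite -sL; case: leqP => [/(nth_default i0) -> //|ltx]; first by rewrite eqxx.
  by apply: contraNF L0 => /eqP <-; apply: mem_nth.
move=> m i ii; rewrite -(cL i ii) -sum1_count (big_nth i0) -sum1dep_card.
rewrite big_mkcond [leqRHS]big_mkcond.
rewrite -(big_mkord xpredT (fun x => if nth i0 L x == i then 1 else 0)) /=.
(* [m] may lie on either side of [size L], so both counts are compared with the range up to
   [size L + m]; terms past the end of [L] vanish. *)
have -> : \sum_(0 <= k < size L) (if nth i0 L k == i then 1 else 0) =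
    \sum_(0 <= k < size L + m) (if nth i0 L k == i then 1 else 0).
  rewrite [RHS](@big_cat_nat _ _ _ (size L)) ?leq_addr //= [X in _ + X]big_nat_cond.
  rewrite [X in _ + X]big1 ?addn0 // => k /andP[/andP[le_k _] _].
  by rewrite nth_default // eq_sym (negPf ii).
by rewrite [leqRHS](@big_cat_nat _ _ _ m) ?leq_addl //= leq_addr.
Qed.

(** * Counting nonadjacent pairs in [complete_star] *)

Lemma card_ord_geq p k : #|[set i : 'I_p | k <= i]| = p - k.
Proof.
rewrite -sum1dep_card -[RHS]muln1 -sum_nat_const_nat.
by rewrite (big_geq_mkord k p xpredT (fun=> 1)).
Qed.

Lemma card_complete_star_missing p k :
  #|[set x : complete_star p k * complete_star p k |
      (x.1 != x.2) && ~~ adj x.1 x.2]| <= (p - k).*2.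
Proof.
pose A := [set i : 'I_p | k <= i].
apply: (@leq_trans #|[set ((None : option 'I_p), Some i) | i in A]
                      :|: [set (Some i, (None : option 'I_p)) | i in A]|).
  apply: subset_leq_card; apply/subsetP=> -[[i|] [j|]]; rewrite in_setU inE /=.
  - by rewrite (inj_eq Some_inj) andbN.
  - rewrite -leqNgt => ki.
    by rewrite (imset_f (fun i => (Some i, None))) ?orbT // inE.
  - by rewrite -leqNgt => kj; rewrite (imset_f (fun i => (None, Some i))) // inE.
  by [].
apply: leq_trans (leq_card_setU _ _) _; rewrite -addnn -(card_ord_geq p k).
by apply: leq_add; apply: leq_imset_card.
Qed.

Lemma arrows_mono_matching (G : sgraph) c (n : 'I_c -> nat) :
  arrows G (fun i => nK2 (n i)) <->
  forall col : coloring G c, exists i, mono_matching col i (n i).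
Proof.
by split=> h col; have [i hi] := h col; exists i; apply/mono_copy_matching.
Qed.

(** * Ramsey and star-critical numbers of matchings *)

Section RamseyMatchings.

Variables (c : nat) (i0 : 'I_c) (n : 'I_c -> nat).
Hypotheses (n_le : forall i, n i <= n i0) (n_pos : forall i, 0 < n i).

Let K := \sum_(i < c | i != i0) (n i - 1).
(** The Ramsey number [n_1 + 1 + sum (n_i - 1)] with the summand of [i0] absorbed. *)
Let N := (n i0).*2 + K.

Lemma dense_arrows (G : sgraph) :
    N <= #|G| ->
    #|[set p : G * G | (p.1 != p.2) && ~~ adj p.1 p.2]| <= 4 * (n i0 - 1) ->
  arrows G (fun i => nK2 (n i)).
Proof.
move=> leN missing; apply/arrows_mono_matching=> col.
have t_le i : n i - 1 <= n i0 - 1 by rewrite leq_sub2r.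
have [|i hi] := dense_mono_matching col t_le _ missing.
  rewrite (bigD1 i0) //= -/K; apply: leq_trans leN.
  by have := n_pos i0; rewrite /N; lia.
by exists i; move: hi; rewrite subn1 prednK.
Qed.

Lemma complete_arrows : arrows (complete N) (fun i => nK2 (n i)).
Proof.
apply: dense_arrows; first by rewrite card_ord.
rewrite (_ : [set _ | _] = set0) ?cards0 //.
by apply/setP=> p; rewrite !inE andbN.
Qed.

(** The added vertex misses [N - 1 - (K + 1) = 2 * (n i0 - 1)] vertices; as ordered pairs this is
    exactly the allowance of [dense_arrows]. *)
Lemma complete_star_arrows :
  arrows (complete_star N.-1 K.+1) (fun i => nK2 (n i)).
Proof.
have n0 := n_pos i0; apply: dense_arrows.
  by rewrite card_option card_ord; lia.
by apply: leq_trans (card_complete_star_missing _ _) _; lia.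
Qed.

(** At most [2 * n i0 - 1] vertices get the label [i0], one too few for [n i0] disjoint edges. *)
Lemma complete_not_arrows m :
  m < N -> ~ arrows (complete m) (fun i => nK2 (n i)).
Proof.
move=> ltm /arrows_mono_matching arr.
have [h [hK h_card]] := labelling_exists i0 (fun i => n i - 1).
have [|x y _ /eqP||col no_mono] := @labelled_coloring (complete m) c i0 n
  (fun x : 'I_m => h x) [set x : 'I_m | K <= x].
- by move=> i /(h_card m i) le_i; apply: leq_ltn_trans le_i _; have := n_pos i; lia.
- by rewrite hK inE.
- by rewrite card_ord_geq; have := n_pos i0; move: ltm; rewrite /N; lia.
by have [i /no_mono] := arr col.
Qed.

(** The added vertex is labelled [i0], but its neighbors are among the first [K] vertices, none
    labelled [i0]. Hence it lies on no edge of color [i0], and [2 * n i0 - 1] vertices remain for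
    that color. *)
Lemma complete_star_not_arrows j :
  j <= K -> ~ arrows (complete_star N.-1 j) (fun i => nK2 (n i)).
Proof.
move=> lej /arrows_mono_matching arr; have n0 := n_pos i0.
have [h [hK h_card]] := labelling_exists i0 (fun i => n i - 1).
have [|||col no_mono] := @labelled_coloring (complete_star N.-1 j) c i0 n
  (fun x => if x is Some i then h (i : 'I_N.-1) else i0)
  [set Some i | i in [set x : 'I_N.-1 | K <= x]].
- move=> i ii; have := h_card N.-1 i ii; have := n_pos i.
  rewrite -(card_imset _ (@Some_inj _)) => ni le_i.
  apply: (@leq_ltn_trans (n i - 1)); last by lia.
  apply: leq_trans le_i; apply: subset_leq_card; apply/subsetP=> -[x|]; rewrite inE.
    by move=> hx; apply: imset_f; rewrite inE.
  by rewrite eq_sym (negPf ii).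
- move=> [x|] [y|] //=.
  + by move=> _ /eqP; rewrite hK => hx _; apply: imset_f; rewrite inE.
  + by move=> _ /eqP; rewrite hK => hx _; apply: imset_f; rewrite inE.
  by move=> ltj _ /eqP; rewrite hK -/K; lia.
- by rewrite (card_imset _ (@Some_inj _)) card_ord_geq; lia.
by have [i /no_mono] := arr col.
Qed.

End RamseyMatchings.

Theorem theorem2 (c : nat) (hc : 0 < c) (n : 'I_c -> nat)
  (n_noninc : forall i j : 'I_c, i <= j -> n j <= n i)
  (n_pos : forall i : 'I_c, 1 <= n i) :
  let N := n (Ordinal hc) + 1 + \sum_(i < c) (n i - 1) in
  let k := \sum_(i < c | 0 < i) (n i - 1) + 1 in
  is_star_critical_ramsey_number (fun i => nK2 (n i)) k /\
  is_least (fun j => 0 < j <= N.-1 /\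
      forall col : coloring (complete_star N.-1 j) c,
        exists i : 'I_c, mono_matching col i (n i)) k.
Proof.
set i0 := Ordinal hc => N k.
have n_le i : n i <= n i0 by apply: n_noninc.
pose K := \sum_(i < c | i != i0) (n i - 1).
have kE : k = K.+1.
  by rewrite /k addn1; congr S; apply: eq_bigl => i; rewrite -val_eqE lt0n.
have NE : N = (n i0).*2 + K.
  by rewrite /N (bigD1 i0) //= -/K; have := n_pos i0; lia.
have ltk : 0 < k <= N.-1 by rewrite kE NE; have := n_pos i0; lia.
have star_k : arrows (complete_star N.-1 k) (fun i => nK2 (n i)).
  by rewrite NE kE; apply: complete_star_arrows.
have star_min j : arrows (complete_star N.-1 j) (fun i => nK2 (n i)) -> k <= j.
  move=> arr; rewrite leqNgt; apply/negP.
  rewrite kE ltnS => /complete_star_not_arrows.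
  by rewrite -NE; apply.
(* The matching form follows through [arrows_mono_matching]; the other claim also needs [N] to be
   the Ramsey number. *)
split; last first.
  split; first by split; last exact/arrows_mono_matching.
  by move=> j [_ /arrows_mono_matching/star_min].
exists N; last by split=> // j [_ /star_min].
split; first by rewrite NE; apply: complete_arrows.
move=> m arr; rewrite leqNgt; apply/negP; rewrite NE => /complete_not_arrows.
exact.
Qed.
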